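(* Let $\Theta\subset\mathbb{R}^n$ be a compact smooth manifold with or without boundary, let $\phi:\Theta\to\Theta$ be a homeomorphism, and let $A:\Theta\to \mathrm{SL}_d(\mathbb{R})$ be a continuous map, regarded as (the generator of) a discrete-time cocycle over $\phi$. Then the discrete-time cocycle $A$ has a canonical extension if and only if the map $A:\Theta\to \mathrm{SL}_d(\mathbb{R})$ is nullhomotopic.
   Context: Discrete-time cocycle: for continuous $A:\Theta\to\mathrm{SL}_d(\mathbb{R})$, $\theta\mapsto A_\theta$, and $n\in\mathbb{Z}$, the $n$-step map is $A^n_\theta = A_{\phi^{n-1}\theta}\cdots A_{\phi\theta}A_\theta$ for $n>0$, $A^0_\theta=\mathrm{Id}$, and $A^n_\theta = A^{-1}_{\phi^{n}\theta}\cdots A^{-1}_{\phi^{-2}\theta}A^{-1}_{\phi^{-1}\theta}$ for $n<0$ (so $A^n_\theta$ is never the matrix power). Mapping torus and suspension flow: $\Theta_1 = (\Theta\times[0,1])/\sim$ with $(\theta,1)\sim(\phi(\theta),0)$, with the quotient topology. The suspension flow $\phi^t:\Theta_1\to\Theta_1$, $t\in\mathbb{R}$, is $\phi^t(\theta,r) = (\phi^{\lfloor r+t\rfloor}\theta,\ r+t \bmod 1)$. Continuous-time cocycle over the suspension flow: given a continuous map (generator) $G:\Theta_1\to\mathfrak{sl}_d(\mathbb{R})$ (real trace-zero $d\times d$ matrices), the continuous-time cocycle generated by $G$ is the map $\Phi:\Theta_1\times\mathbb{R}\to\mathrm{SL}_d(\mathbb{R})$, $((\theta,r),t)\mapsto\Phi^t_{(\theta,r)}$,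 that is the unique solution of $\Phi^0_{(\theta,r)}=\mathrm{Id}$, $\partial_t\Phi^t_{(\theta,r)} = G(\phi^t(\theta,r))\,\Phi^t_{(\theta,r)}$. A continuous-time cocycle always means one generated by such a continuous $G$. Canonical extension: a continuous-time cocycle $\Phi$ over the suspension flow $\phi^t:\Theta_1\to\Theta_1$ is a canonical extension of $A$ if $\Phi^n_{(\theta,0)} = A^n_\theta$ for all $n\in\mathbb{Z}$ and all $\theta\in\Theta$. Nullhomotopic: a continuous map into a connected space is nullhomotopic if it is homotopic (through continuous maps) to a constant map. *)

(* Defs.v *)
From HB Require Import structures.
From mathcomp Require Import all_boot all_order all_algebra generic_quotient.
From mathcomp Require Import all_classical all_reals all_analysis.
From mathcomp Require Import ring.

Set Implicit Arguments.
Unset Strict Implicit.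
Unset Printing Implicit Defensive.

Import Order.TTheory GRing.Theory Num.Theory.
Import numFieldNormedType.Exports.

Local Open Scope classical_set_scope.
Local Open Scope ring_scope.
Local Open Scope quotient_scope.

(** Smooth manifolds, possibly with boundary, as subsets of Euclidean space,
    following Milnor and Guillemin-Pollack. *)
Section Manifold.
Context {R : realType}.

(** All iterated partial derivatives of order at most [k] exist and are
    continuous at every point of [U]; only meant for open [U]. *)
Fixpoint Ck {m p : nat} (k : nat) (U : set 'rV[R]_m)
    (f : 'rV[R]_m -> 'rV[R]_p) : Prop :=
  (forall x, U x -> {for x, continuous f}) /\
  if k is k'.+1 then
    forall i : 'I_m,
      (forall x, U x -> derivable f x (delta_mx 0 i)) /\
      Ck k' U (fun x => 'D_(delta_mx 0 i) f x)
  else True.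

(** Smoothness on an arbitrary subset: [f] extends, locally around each point
    of [X], to a C^oo map on an open subset of the ambient space. *)
Definition smooth_on {m p : nat} (X : set 'rV[R]_m)
    (f : 'rV[R]_m -> 'rV[R]_p) : Prop :=
  forall x, X x -> exists (U : set 'rV[R]_m) (g : 'rV[R]_m -> 'rV[R]_p),
    [/\ open U, U x, forall k, Ck k U g & {in U `&` X, f =1 g}].

Definition diffeomorphic {m p : nat} (X : set 'rV[R]_m) (Y : set 'rV[R]_p) :=
  exists (f : 'rV[R]_m -> 'rV[R]_p) (g : 'rV[R]_p -> 'rV[R]_m),
    [/\ smooth_on X f, set_fun X Y f & {in X, cancel f g}] /\
    [/\ smooth_on Y g, set_fun Y X g & {in Y, cancel g f}].

(** The last coordinate is nonnegative; this is all of R^0 when [k] is 0. *)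
Definition half_space (k : nat) : set 'rV[R]_k :=
  [set y | forall i : 'I_k, i.+1 = k -> 0 <= y 0 i].
Arguments half_space k : clear implicits.

(** Interior points are covered too: open subsets of R^k can be translated
    locally into the interior of the half space. *)
Definition smooth_manifold {n : nat} (X : set 'rV[R]_n) : Prop :=
  exists k : nat, forall x, X x ->
    exists (W : set 'rV[R]_n) (V : set 'rV[R]_k),
      [/\ open W, W x, open V & diffeomorphic (X `&` W) (half_space k `&` V)].

End Manifold.

Definition SL (R : realType) (d : nat) : set 'M[R]_d := [set M | \det M = 1].
Arguments SL R d : clear implicits.

Definition sl (R : realType) (d : nat) : set 'M[R]_d := [set M | \tr M = 0].
Arguments sl R d : clear implicits.

Record homeo (T : topologicalType) := Homeo {
  homeo_fun :> T -> T;
  homeo_inv : T -> T;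
  homeo_funK : cancel homeo_fun homeo_inv;
  homeo_invK : cancel homeo_inv homeo_fun;
  homeo_continuous : continuous homeo_fun;
  homeo_inv_continuous : continuous homeo_inv }.

Definition homeo_iter (T : topologicalType) (phi : homeo T) (n : int) : T -> T :=
  match n with
  | Posz m => iter m phi
  | Negz m => iter m.+1 (homeo_inv phi)
  end.

(** [discrete_cocycle phi A n theta] is A^n_theta. *)
Section DiscreteCocycle.
Context {R : realType} {d : nat} {T : topologicalType}.
Variables (phi : homeo T) (A : T -> SL R d).

Fixpoint forward_cocycle (m : nat) (theta : T) : 'M[R]_d :=
  if m is m'.+1 then
    set_val (A (iter m' phi theta)) *m forward_cocycle m' theta
  else 1%:M.

Fixpoint backward_cocycle (m : nat) (theta : T) : 'M[R]_d :=
  if m is m'.+1 then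
    invmx (set_val (A (iter m (homeo_inv phi) theta)))
      *m backward_cocycle m' theta
  else 1%:M.

Definition discrete_cocycle (n : int) : T -> 'M[R]_d :=
  match n with
  | Posz m => forward_cocycle m
  | Negz m => backward_cocycle m.+1
  end.

End DiscreteCocycle.

Definition I01 (R : realType) : set R := `[0, 1]%classic.
Arguments I01 R : clear implicits.

Section UnitInterval.
Context {R : realType}.

Fact I01_0 : (0 : R) \in I01 R.
Proof. by rewrite inE /I01 /= in_itv /= lexx ler01. Qed.

Fact I01_1 : (1 : R) \in I01 R.
Proof. by rewrite inE /I01 /= in_itv /= lexx ler01. Qed.

Fact I01_frac (x : R) : x - (Num.floor x)%:~R \in I01 R.
Proof.
have /andP[lex ltx] := real_floor_itv (num_real x).
rewrite inE /I01 /= in_itv /= subr_ge0 lex /= lerBlDl ltW//.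
by rewrite intrD in ltx.
Qed.

Definition zero01 : I01 R := SigSub I01_0.
Definition one01 : I01 R := SigSub I01_1.

(** The residue of [x] mod 1. *)
Definition frac01 (x : R) : I01 R := SigSub (I01_frac x).

End UnitInterval.

Section Homotopy.
Context (R : realType) {X Y : topologicalType}.

Definition homotopic (f g : X -> Y) : Prop :=
  exists H : (X * I01 R)%type -> Y,
    [/\ continuous H, forall x, H (x, zero01) = f x
      & forall x, H (x, one01) = g x].

Definition nullhomotopic (f : X -> Y) : Prop :=
  exists y : Y, homotopic f (fun=> y).

End Homotopy.

Section Suspension.
Context (R : realType) {T : topologicalType} (phi : homeo T).

(** The relation identifying (theta, 1) with (phi theta, 0). *)
Definition torus_glue (x y : (T * I01 R)%type) : bool :=
  [&& x.2 == one01, y.2 == zero01 & y.1 == phi x.1].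

(** Since [phi] is injective, the reflexive symmetric closure of [torus_glue]
    is already transitive. *)
Definition torus_rel (x y : (T * I01 R)%type) : bool :=
  [|| x == y, torus_glue x y | torus_glue y x].

Fact zero01_neq_one01 : (zero01 == one01 :> I01 R) = false.
Proof.
by apply/negP => /eqP/(congr1 set_val)/eqP; rewrite /= eq_sym oner_eq0.
Qed.

Fact torus_rel_equiv : equiv_class_of torus_rel.
Proof.
have inj := can_inj (homeo_funK phi).
split.
- by move=> x; rewrite /torus_rel eqxx.
- by move=> x y; rewrite /torus_rel eq_sym; congr orb; rewrite orbC.
- move=> [b j] [a i] [c k]; rewrite /torus_rel /torus_glue /=.
  case/or3P => [/eqP[-> ->]//|/and3P[/eqP-> /eqP-> /eqP->]|
                /and3P[/eqP-> /eqP-> /eqP->]].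
  + case/or3P => [/eqP[<- <-]|/and3P[/eqP E]|/and3P[/eqP-> _ /eqP/inj->]].
    * by rewrite !eqxx orbT.
    * by have := zero01_neq_one01; rewrite E eqxx.
    * by rewrite eqxx.
  + case/or3P => [/eqP[<- <-]|/and3P[_ /eqP-> /eqP->]|/and3P[_ /eqP E]].
    * by rewrite !eqxx !orbT.
    * by rewrite eqxx.
    * by have := zero01_neq_one01; rewrite -E eqxx.
Qed.

Canonical torus_equiv := EquivRelPack torus_rel_equiv.

Definition mapping_torus : topologicalType :=
  quotient_topology {eq_quot torus_equiv}.

Definition torus_pi (theta : T) (r : I01 R) : mapping_torus :=
  \pi_({eq_quot torus_equiv}) (theta, r).

(** The flow is computed on a representative; [susp_flowE] shows that the
    choice is irrelevant. *)
Definition susp_flow (t : R) (x : mapping_torus) : mapping_torus :=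
  let: (theta, r) := repr (x : {eq_quot torus_equiv}) in
  torus_pi (homeo_iter phi (Num.floor (set_val r + t)) theta)
           (frac01 (set_val r + t)).

Lemma homeo_iterS (n : int) (theta : T) :
  homeo_iter phi (n + 1) theta = homeo_iter phi n (phi theta).
Proof.
case: n => [m|[|m]].
- by have -> : Posz m + 1 = m.+1 by [rewrite intS addrC]; exact: iterSr.
- by have -> : Negz 0 + 1 = 0 by []; rewrite /= homeo_funK.
- have -> : Negz m.+1 + 1 = Negz m.
    by rewrite !NegzE [X in - X]intS opprD addrAC addNr add0r.
  by rewrite /homeo_iter [RHS]iterSr homeo_funK.
Qed.

Lemma frac01D1 (x : R) : frac01 (1 + x) = frac01 x.
Proof.
apply: val_inj => /=.
have -> : Num.floor (1 + x) = 1 + Num.floor x by rewrite floorDzr ?rpred1 ?floor1.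
by rewrite intrD; ring.
Qed.

Lemma susp_flowE (t : R) (theta : T) (r : I01 R) :
  susp_flow t (torus_pi theta r) =
  torus_pi (homeo_iter phi (Num.floor (set_val r + t)) theta)
           (frac01 (set_val r + t)).
Proof.
have floor1D : Num.floor (1 + t) = Num.floor t + 1.
  by rewrite floorDzr ?rpred1 ?floor1 // addrC.
rewrite /susp_flow /torus_pi.
case: piP => -[theta' r'] /eqmodP /=; rewrite /torus_rel /torus_glue /=.
case/or3P => [/eqP[-> ->]//| |] /and3P[/eqP-> /eqP-> /eqP->] /=.
- by rewrite add0r frac01D1 floor1D homeo_iterS.
- by rewrite add0r frac01D1 floor1D homeo_iterS.
Qed.

End Suspension.

Section CanonicalExtension.
Context {R : realType} {d : nat} {T : topologicalType} (phi : homeo T).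

(** The linear initial value problem has a unique solution, so this says that
    [Phi] is the cocycle generated by [G]. *)
Definition generates (G : mapping_torus R phi -> sl R d)
    (Phi : mapping_torus R phi -> R -> SL R d) : Prop :=
  forall x : mapping_torus R phi,
    set_val (Phi x 0) = 1%:M /\
    forall t : R,
      is_derive t 1 (fun s => set_val (Phi x s))
        (set_val (G (susp_flow t x)) *m set_val (Phi x t)).

Definition continuous_time_cocycle
    (Phi : mapping_torus R phi -> R -> SL R d) : Prop :=
  exists2 G : mapping_torus R phi -> sl R d, continuous G & generates G Phi.

Definition canonical_extension (A : T -> SL R d)
    (Phi : mapping_torus R phi -> R -> SL R d) : Prop :=
  continuous_time_cocycle Phi /\
  forall (n : int) (theta : T),
    set_val (Phi (torus_pi phi theta zero01) n%:~R) =
    discrete_cocycle phi A n theta.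

End CanonicalExtension.

(* Main.v *)
(** If [A] has a canonical extension [Phi], then [Phi^(1 - s)_(theta, 0)],
    0 <= s <= 1, is a homotopy from [A] to the identity; its joint continuity is
    the continuous dependence on parameters of a linear ODE (Gronwall).

    Conversely, call a map X -> SL_d flat-isotopic to the identity when it is
    the time-1 value of a path B(x, t) from the identity, C^1 in t, with
    dB/dt = G B for a continuous trace-free G vanishing at times 0 and 1.  Maps
    into unipotent block matrices have this property (multiply the off-diagonal
    block by a C^1 cutoff) and the property is stable under products.  Gaussian
    elimination writes every map into a small neighbourhood of a given matrix of
    SL_d as a product of unipotent maps.  Along a homotopy H over a compact X
    the quotients H_t H_s^-1 are close to the identity when t is close to s, so
    the set of times t for which H_t is flat-isotopic to the identity is open and
    closed.  A nullhomotopic [A] is therefore flat-isotopic to the identity.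
    Concatenating the paths B over the orbits of [phi] gives the extension, and
    the generator descends to the mapping torus since G vanishes at 0 and 1. *)

Require Import Defs.
From mathcomp Require Import all_boot all_order all_algebra generic_quotient.
From mathcomp Require Import all_classical all_reals all_analysis.
From mathcomp Require Import ring lra.

Set Implicit Arguments.
Unset Strict Implicit.
Unset Printing Implicit Defensive.

Import Order.TTheory GRing.Theory Num.Theory.
Import numFieldNormedType.Exports.

Local Open Scope classical_set_scope.
Local Open Scope ring_scope.

(** * Entrywise limits and derivatives of matrix-valued maps *)

Section MatrixCalculus.
Context {R : realType}.

Lemma cvg_mxP {m n : nat} {T : Type} (F : set_system T) {FF : Filter F}
    (f : T -> 'M[R]_(m, n)) (M : 'M[R]_(m, n)) :
  f @ F --> M <-> forall i j, (fun x => f x i j) @ F --> M i j.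
Proof.
split=> [cf i j|cf A [P MP PA]].
  exact: (cvg_comp _ _ cf (@coord_continuous R m n i j M)).
apply: (@filterS _ F _ [set x | forall i j, P i j (f x i j)]).
  by move=> x /PA.
apply: filter_forall => i; apply: filter_forall => j; exact: cf (MP i j).
Qed.

Lemma cvg_mulmx {m n p : nat} {T : Type} (F : set_system T) {FF : Filter F}
    (f : T -> 'M[R]_(m, n)) (g : T -> 'M[R]_(n, p))
    (M : 'M[R]_(m, n)) (N : 'M[R]_(n, p)) :
  f @ F --> M -> g @ F --> N -> (fun x => f x *m g x) @ F --> M *m N.
Proof.
move=> /cvg_mxP cf /cvg_mxP cg; apply/cvg_mxP => i j.
under eq_fun do rewrite mxE; rewrite mxE.
apply: cvg_big => [|k _]; first exact: add_continuous.
exact: cvgM.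
Qed.

Lemma cvg_det {n : nat} {T : Type} (F : set_system T) {FF : Filter F}
    (f : T -> 'M[R]_n) (M : 'M[R]_n) :
  f @ F --> M -> (fun x => \det (f x)) @ F --> \det M.
Proof.
move=> /cvg_mxP cf; rewrite /determinant.
apply: cvg_big => [|s _]; first exact: add_continuous.
apply: cvgM; first exact: cvg_cst.
by apply: cvg_big => [|k _]; [exact: mul_continuous|exact: cf].
Qed.

(** At determinant 1 the inverse is the adjugate, whose entries are signed minors and hence
    polynomial in the entries of the matrix. *)
Lemma cvg_invmx {n : nat} {T : Type} (F : set_system T) {FF : Filter F}
    (f : T -> 'M[R]_n) (M : 'M[R]_n) :
  f @ F --> M -> (forall x, \det (f x) = 1) ->
  \det M = 1 -> (fun x => invmx (f x)) @ F --> invmx M.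
Proof.
move=> cf df dM.
have invE (N : 'M[R]_n) : \det N = 1 -> invmx N = \adj N.
  by move=> dN; rewrite /invmx unitmxE dN unitr1 invr1 scale1r.
under eq_fun do rewrite invE //; rewrite invE //.
apply/cvg_mxP => i j; under eq_fun do rewrite mxE; rewrite mxE.
apply: cvgM; first exact: cvg_cst.
apply: cvg_det; apply/cvg_mxP => k l.
under eq_fun do rewrite !mxE; rewrite !mxE.
by move/cvg_mxP : cf; apply.
Qed.

Lemma is_derive_mxP {m n : nat} (f : R -> 'M[R]_(m, n)) (t : R) D :
  is_derive t 1 f D <-> forall i j, is_derive t 1 (fun s => f s i j) (D i j).
Proof.
split=> [[df <-] i j|df].
  by apply: DeriveDef; [exact: (derivable_mxP _ _ _).1|rewrite derive_mx// mxE].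
have df' : derivable f t 1 by apply/derivable_mxP => i j; case: (df i j).
apply: DeriveDef => //; rewrite derive_mx//; apply/matrixP => i j.
by rewrite mxE; case: (df i j).
Qed.

Lemma is_derive_mulmx {m n p : nat} (f : R -> 'M[R]_(m, n))
    (g : R -> 'M[R]_(n, p)) (t : R) Df Dg :
  is_derive t 1 f Df -> is_derive t 1 g Dg ->
  is_derive t 1 (fun s => f s *m g s) (Df *m g t + f t *m Dg).
Proof.
move=> /is_derive_mxP df /is_derive_mxP dg; apply/is_derive_mxP => i j.
have -> : (fun s => (f s *m g s) i j) =
    \sum_k ((fun s => f s i k) * (fun s => g s k j)).
  by apply/funext => s; rewrite mxE fct_sumE.
apply: (@is_derive_eq _ _ _ _ _ _ _ _ (is_derive_sum _)).
rewrite !mxE -big_split/=; apply: eq_bigr => k _.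
by rewrite addrC /GRing.scale/=; congr (_ + _); rewrite mulrC.
Qed.

End MatrixCalculus.

(** * A C^1 cutoff function and its derivative *)

Section Cutoff.
Context {R : realType}.

(** The truncated square is C^1 and vanishes on a half-line; its shifts are the building blocks of a
    quadratic spline. *)
Definition sqpos (x : R) : R := Num.max 0 x ^+ 2.

Lemma is_derive_sqpos (x : R) : is_derive x 1 sqpos (2 * Num.max 0 x).
Proof.
have [x0|x0|->] := ltgtP x 0.
- apply: (near_eq_is_derive (f := cst 0)).
    near=> y; rewrite /sqpos max_l ?expr0n//.
    by apply: ltW; near: y; exact: lt_nbhsl.
  by rewrite ?mulr0; exact: is_derive_cst.
- apply: (@near_eq_is_derive R R R ((id : R -> R) ^+ 2)).
    near=> y; rewrite /sqpos max_r//.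
    by apply: ltW; near: y; exact: lt_nbhsr.
  by apply: is_derive_eq; rewrite /= /GRing.scale/= mulr1 expr1.
(* Since [sqpos z = Num.max 0 z * z], the slope function at 0 is [Num.max 0 z], which is continuous
   with value 0 there. *)
- rewrite mulr0; apply/is_derive1_caratheodory.
  exists (fun z => Num.max 0 z); split.
  + move=> z; rewrite /sqpos subr0 maxxx expr0n subr0.
    by case: ltgtP => [z0|z0|<-]; rewrite ?mul0r ?mulr0 ?expr0n// expr2.
  + by apply: continuous_max; [exact: cvg_cst|exact: cvg_id].
  + by rewrite maxxx.
Unshelve. all: by end_near. Qed.

(** Quadratic spline with knots 0, 1/2, 1. The weights 1, -2, 1 cancel the quadratic and linear
    terms past 1 and leave the constant 1/2, which the factor 2 normalises. *)
Definition cutoff (t : R) : R :=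
  2 * (sqpos t - 2 * sqpos (t - 2^-1) + sqpos (t - 1)).

Definition dcutoff (t : R) : R :=
  4 * (Num.max 0 t - 2 * Num.max 0 (t - 2^-1) + Num.max 0 (t - 1)).

Lemma is_derive_cutoff (t : R) : is_derive t 1 cutoff (dcutoff t).
Proof.
have dsh (c : R) :
    is_derive t 1 (fun s => sqpos (s - c)) (2 * Num.max 0 (t - c)).
  rewrite -[X in is_derive _ _ _ X]mulr1.
  apply: (@is_derive1_comp _ sqpos (fun s => s - c)).
    exact: is_derive_sqpos.
  exact: (@is_derive_shift R t 1 (- c)).
have ds := @is_derive_sqpos t; have dh := dsh 2^-1; have d1 := dsh 1.
have := is_deriveZ 2 (is_deriveD (is_deriveB ds
  (is_deriveZ 2 dh)) d1).
move=> dc; apply: (is_derive_eq dc).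
by rewrite /dcutoff /GRing.scale/=; ring.
Qed.

Lemma continuous_dcutoff : continuous dcutoff.
Proof.
have cmax (c : R) : continuous (fun s : R => Num.max 0 (s - c)).
  move=> s; apply: (@continuous_max R R (cst 0) (fun s => s - c)).
    exact: cvg_cst.
  by apply: cvgB; [exact: cvg_id|exact: cvg_cst].
move=> s; apply: cvgM; first exact: cvg_cst.
apply: cvgD; last exact: cmax.
apply: cvgB; first by apply: continuous_max; [exact: cvg_cst|exact: cvg_id].
by apply: cvgM; [exact: cvg_cst|exact: cmax].
Qed.

Lemma continuous_cutoff : continuous cutoff.
Proof.
move=> t; apply/differentiable_continuous/derivable1_diffP.
by have [] := is_derive_cutoff t.
Qed.

Lemma cutoff_le0 (t : R) : t <= 0 -> cutoff t = 0.
Proof. by move=> t0; rewrite /cutoff /sqpos !max_l; [ring|lra..]. Qed.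

Lemma cutoff_ge1 (t : R) : 1 <= t -> cutoff t = 1.
Proof. by move=> t1; rewrite /cutoff /sqpos !max_r; [field|lra..]. Qed.

Lemma dcutoff_out (t : R) : t <= 0 \/ 1 <= t -> dcutoff t = 0.
Proof.
case=> t0; rewrite /dcutoff; first by rewrite !max_l; [ring|lra..].
by rewrite !max_r; [field|lra..].
Qed.

End Cutoff.

(** * Flat isotopies to the identity: products and unipotent blocks *)

Section FlatIsotopy.
Context {R : realType} {X : topologicalType}.

(** [B] is constant in time outside [0, 1]; time-shifted copies of [B] can then
    be multiplied together instead of being glued at integer times. *)
Record flat_path {d : nat} (A : X -> 'M[R]_d) (B G : X * R -> 'M[R]_d) :
    Prop := FlatPath {
  flat_cont : continuous B;
  flat_gen_cont : continuous G;
  flat_tr : forall p, \tr (G p) = 0;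
  flat_det : forall p, \det (B p) = 1;
  flat_derive : forall x (t : R),
    is_derive t 1 (fun s => B (x, s)) (G (x, t) *m B (x, t));
  flat_le0 : forall x t, t <= 0 -> B (x, t) = 1%:M;
  flat_ge1 : forall x t, 1 <= t -> B (x, t) = A x;
  flat_gen_out : forall x t, t <= 0 \/ 1 <= t -> G (x, t) = 0 }.

Definition flat_isotopic {d : nat} (A : X -> 'M[R]_d) : Prop :=
  exists B G, flat_path A B G.

Lemma flat_isotopic1 d : flat_isotopic (fun=> 1%:M : 'M[R]_d).
Proof.
exists (fun=> 1%:M), (fun=> 0); split => //.
- by move=> p; exact: cvg_cst.
- by move=> p; exact: cvg_cst.
- by move=> p; rewrite mxtrace0.
- by move=> p; rewrite det1.
- by move=> x t; rewrite mul0mx; exact: is_derive_cst.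
Qed.

Lemma eq_flat_isotopic d (A1 A2 : X -> 'M[R]_d) :
  (forall x, A1 x = A2 x) -> flat_isotopic A2 -> flat_isotopic A1.
Proof. by move=> /funext ->. Qed.

(** The path [B1 B2] has generator [G1 + B1 G2 B1^-1]: conjugation keeps the trace zero, and the sum
    vanishes wherever [G1] and [G2] both do. *)
Lemma flat_isotopic_mul d (A1 A2 : X -> 'M[R]_d) :
  flat_isotopic A1 -> flat_isotopic A2 ->
  flat_isotopic (fun x => A1 x *m A2 x).
Proof.
move=> [B1 [G1 [cB1 cG1 tr1 det1 dB1 le1 ge1 out1]]].
move=> [B2 [G2 [cB2 cG2 tr2 det2 dB2 le2 ge2 out2]]].
have U1 p : B1 p \in unitmx by rewrite unitmxE det1 unitr1.
exists (fun p => B1 p *m B2 p), (fun p => G1 p + B1 p *m G2 p *m invmx (B1 p)).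
split.
- by move=> p; apply: cvg_mulmx; [exact: cB1|exact: cB2].
- move=> p; apply: cvgD; first exact: cG1.
  apply: cvg_mulmx; first by apply: cvg_mulmx; [exact: cB1|exact: cG2].
  by apply: cvg_invmx; [exact: cB1| |].
- by move=> p; rewrite mxtraceD tr1 add0r mxtrace_mulC mulmxA mulVmx// mul1mx.
- by move=> p; rewrite det_mulmx det1 det2 mulr1.
- move=> x t; have := is_derive_mulmx (dB1 x t) (dB2 x t).
  by rewrite mulmxDl -!mulmxA (mulmxA (invmx _)) mulVmx// mul1mx.
- by move=> x t t0; rewrite le1// le2// mulmx1.
- by move=> x t t0; rewrite ge1// ge2.
- by move=> x t t0; rewrite out1// out2// mulmx0 mul0mx addr0.
Qed.

Lemma cvg_block_mx {m1 m2 n1 n2 : nat} {T : Type} (F : set_system T)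
    {FF : Filter F} (a : T -> 'M[R]_(m1, n1)) (b : T -> 'M[R]_(m1, n2))
    (c : T -> 'M[R]_(m2, n1)) (e : T -> 'M[R]_(m2, n2))
    (a' : 'M[R]_(m1, n1)) (b' : 'M[R]_(m1, n2))
    (c' : 'M[R]_(m2, n1)) (e' : 'M[R]_(m2, n2)) :
  a @ F --> a' -> b @ F --> b' -> c @ F --> c' -> e @ F --> e' ->
  (fun x => block_mx (a x) (b x) (c x) (e x)) @ F --> block_mx a' b' c' e'.
Proof.
move=> /cvg_mxP ca /cvg_mxP cb /cvg_mxP cc /cvg_mxP ce; apply/cvg_mxP => i j.
by case: (split_ordP i) => k ->; case: (split_ordP j) => l ->;
   under eq_fun do
     rewrite ?(block_mxEul, block_mxEur, block_mxEdl, block_mxEdr);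
   rewrite ?(block_mxEul, block_mxEur, block_mxEdl, block_mxEdr);
   first [exact: ca|exact: cb|exact: cc|exact: ce].
Qed.

Lemma is_derive_block_mx {m1 m2 n1 n2 : nat} (t : R)
    (a : R -> 'M[R]_(m1, n1)) (b : R -> 'M[R]_(m1, n2))
    (c : R -> 'M[R]_(m2, n1)) (e : R -> 'M[R]_(m2, n2))
    (a' : 'M[R]_(m1, n1)) (b' : 'M[R]_(m1, n2))
    (c' : 'M[R]_(m2, n1)) (e' : 'M[R]_(m2, n2)) :
  is_derive t 1 a a' -> is_derive t 1 b b' ->
  is_derive t 1 c c' -> is_derive t 1 e e' ->
  is_derive t 1 (fun s => block_mx (a s) (b s) (c s) (e s))
    (block_mx a' b' c' e').
Proof.
move=> /is_derive_mxP ca /is_derive_mxP cb /is_derive_mxP cc /is_derive_mxP ce.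
apply/is_derive_mxP => i j.
by case: (split_ordP i) => k ->; case: (split_ordP j) => l ->;
   under eq_fun do
     rewrite ?(block_mxEul, block_mxEur, block_mxEdl, block_mxEdr);
   rewrite ?(block_mxEul, block_mxEur, block_mxEdl, block_mxEdr);
   first [exact: ca|exact: cb|exact: cc|exact: ce].
Qed.

Lemma cvg_cutoffZ {m n : nat} (f : R -> R) (b : X -> 'M[R]_(m, n)) (p : X * R) :
  continuous f -> continuous b ->
  (fun q : X * R => f q.2 *: b q.1) @ p --> f p.2 *: b p.1.
Proof.
move=> cf cb; apply: cvgZ.
  by apply: (@continuous_comp _ _ _ snd f p); [exact: cvg_snd|exact: cf].
by apply: (@continuous_comp _ _ _ fst b p); [exact: cvg_fst|exact: cb].
Qed.

Lemma is_derive_cutoffZ {m n : nat} (b : 'M[R]_(m, n)) (t : R) :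
  is_derive t 1 (fun s => cutoff s *: b) (dcutoff t *: b).
Proof.
apply/is_derive_mxP => i j; rewrite mxE.
under eq_fun do rewrite mxE mulrC.
have := is_deriveZ (b i j) (is_derive_cutoff t).
by rewrite /GRing.scale/= mulrC.
Qed.

(** The off-diagonal part [N] has square zero, so the path [1 + cutoff N] satisfies the equation
    with generator [dcutoff N], which has zero diagonal. *)
Lemma flat_isotopic_unipotent_ur n1 n2 (b : X -> 'M[R]_(n1, n2)) :
  continuous b -> flat_isotopic (fun x => block_mx 1%:M (b x) 0 1%:M).
Proof.
move=> cb.
exists (fun p => block_mx 1%:M (cutoff p.2 *: b p.1) 0 1%:M),
  (fun p => block_mx 0 (dcutoff p.2 *: b p.1) 0 0); split.
- move=> p; apply: cvg_block_mx; try exact: cvg_cst.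
  by apply: cvg_cutoffZ => //; exact: continuous_cutoff.
- move=> p; apply: cvg_block_mx; try exact: cvg_cst.
  by apply: cvg_cutoffZ => //; exact: continuous_dcutoff.
- by move=> p; rewrite mxtrace_block !mxtrace0 addr0.
- by move=> p; rewrite det_ublock !det1 mulr1.
- move=> x t /=; rewrite mulmx_block !mul0mx !mulmx0 !mulmx1 !addr0 !add0r.
  apply: is_derive_block_mx; try exact: is_derive_cst.
  exact: is_derive_cutoffZ.
- by move=> x t t0 /=; rewrite cutoff_le0// scale0r -scalar_mx_block.
- by move=> x t t0 /=; rewrite cutoff_ge1// scale1r.
- by move=> x t t0 /=; rewrite dcutoff_out// scale0r block_mx0.
Qed.

Lemma flat_isotopic_unipotent_dl n1 n2 (c : X -> 'M[R]_(n2, n1)) :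
  continuous c -> flat_isotopic (fun x => block_mx 1%:M 0 (c x) 1%:M).
Proof.
move=> cc.
exists (fun p => block_mx 1%:M 0 (cutoff p.2 *: c p.1) 1%:M),
  (fun p => block_mx 0 0 (dcutoff p.2 *: c p.1) 0); split.
- move=> p; apply: cvg_block_mx; try exact: cvg_cst.
  by apply: cvg_cutoffZ => //; exact: continuous_cutoff.
- move=> p; apply: cvg_block_mx; try exact: cvg_cst.
  by apply: cvg_cutoffZ => //; exact: continuous_dcutoff.
- by move=> p; rewrite mxtrace_block !mxtrace0 addr0.
- by move=> p; rewrite det_lblock !det1 mulr1.
- move=> x t /=; rewrite mulmx_block !mul0mx !mulmx0 !mulmx1 !addr0.
  apply: is_derive_block_mx; try exact: is_derive_cst.
  exact: is_derive_cutoffZ.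
- by move=> x t t0 /=; rewrite cutoff_le0// scale0r -scalar_mx_block.
- by move=> x t t0 /=; rewrite cutoff_ge1// scale1r.
- by move=> x t t0 /=; rewrite dcutoff_out// scale0r block_mx0.
Qed.

Lemma flat_isotopic_diag n1 n2 (S : X -> 'M[R]_n2) :
  flat_isotopic S ->
  flat_isotopic (fun x => block_mx (1%:M : 'M[R]_n1) 0 0 (S x)).
Proof.
move=> [B [G [cB cG trG detB dB le0 ge1 out]]].
exists (fun p => block_mx 1%:M 0 0 (B p)), (fun p => block_mx 0 0 0 (G p)).
split.
- by move=> p; apply: cvg_block_mx; try exact: cvg_cst; exact: cB.
- by move=> p; apply: cvg_block_mx; try exact: cvg_cst; exact: cG.
- by move=> p; rewrite mxtrace_block mxtrace0 add0r.
- by move=> p; rewrite det_ublock det1 mul1r.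
- move=> x t; rewrite mulmx_block !mul0mx !mulmx0 !addr0 !add0r.
  by apply: is_derive_block_mx; try exact: is_derive_cst; exact: dB.
- by move=> x t t0 /=; rewrite le0// -scalar_mx_block.
- by move=> x t t0 /=; rewrite ge1.
- by move=> x t t0 /=; rewrite out// block_mx0.
Qed.

End FlatIsotopy.

(** * Gaussian elimination with continuous unipotent factors *)

Section LocalFactorization.
Context {R : realType}.

Lemma unipotent_ulK n1 n2 (b : 'M[R]_(n1, n2)) :
  block_mx 1%:M (- b) 0 1%:M *m block_mx 1%:M b 0 1%:M = 1%:M.
Proof.
rewrite mulmx_block !mul0mx !mulmx0 !mulmx1 !mul1mx !addr0 add0r subrr.
by rewrite -scalar_mx_block.
Qed.

Lemma unipotent_dlK n1 n2 (c : 'M[R]_(n2, n1)) :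
  block_mx 1%:M 0 (- c) 1%:M *m block_mx 1%:M 0 c 1%:M = 1%:M.
Proof.
rewrite mulmx_block !mul0mx !mulmx0 !mulmx1 !mul1mx !addr0 !add0r addNr.
by rewrite -scalar_mx_block.
Qed.

Section Pivot.
Context {n : nat}.
Variables (v : 'cV[R]_n) (i : 'I_n).
Implicit Types M : 'M[R]_(1 + n).

(** [pivot_col] and [pivot_block] are the lower blocks of [M] once [v] times the first row has been
    added to the lower rows. *)
Definition pivot_col M : 'cV[R]_n := dlsubmx M + v *m ulsubmx M.
Definition pivot_block M : 'M[R]_n := drsubmx M + v *m ursubmx M.
(** The row [w] supported at [i] with [w *m pivot_col M = 1 - M 0 0]; adding [w] times the new lower
    rows to the first row makes the corner 1 and turns the rest of that row into [pivot_row]. *)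
Definition pivot_weight M : 'rV[R]_n :=
  ((1 - M 0 0) / pivot_col M i 0) *: delta_mx 0 i.
Definition pivot_row M : 'rV[R]_n :=
  ursubmx M + pivot_weight M *m pivot_block M.
(** The Schur complement of the corner after it has become 1. *)
Definition schur M : 'M[R]_n := pivot_block M - pivot_col M *m pivot_row M.

(** The first two unipotent factors turn the (0, 0) entry into 1, so that no
    diagonal factor with a variable entry is needed. *)
Lemma pivot_factor M : pivot_col M i 0 != 0 ->
  M = block_mx 1%:M 0 (- v) 1%:M *m (block_mx 1%:M (- pivot_weight M) 0 1%:M *m
      (block_mx 1%:M 0 (pivot_col M) 1%:M *m
      (block_mx 1%:M 0 0 (schur M) *m block_mx 1%:M (pivot_row M) 0 1%:M))).
Proof.
move=> ci0.
have wc : pivot_weight M *m pivot_col M = 1%:M - ulsubmx M.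
  rewrite /pivot_weight -scalemxAl -rowE; move: (pivot_col M) ci0 => c ci0.
  by apply/matrixP => k l; rewrite !ord1 !mxE eqxx !lshift0 divfK.
(* After the two row operations the corner is 1, so the matrix is lower unipotent times block
   diagonal times upper unipotent; inverting the two operations then recovers [M]. *)
have -> : block_mx 1%:M 0 (pivot_col M) 1%:M *m
    (block_mx 1%:M 0 0 (schur M) *m block_mx 1%:M (pivot_row M) 0 1%:M) =
    block_mx 1%:M (pivot_weight M) 0 1%:M *m
    (block_mx 1%:M 0 v 1%:M *m M).
  rewrite /schur /pivot_row; move: (pivot_weight M) wc => w wc.
  rewrite -[M in RHS]submxK !mulmx_block !mul0mx !mulmx0 !mulmx1 !mul1mx.
  rewrite !addr0 !add0r !(addrC (v *m _)) -/(pivot_col M) -/(pivot_block M).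
  rewrite wc [ulsubmx M + _]addrC subrK mulmx1.
  by rewrite [X in block_mx _ _ _ X]addrC subrK.
rewrite [X in _ = _ *m X]mulmxA unipotent_ulK mul1mx.
by rewrite mulmxA unipotent_dlK mul1mx.
Qed.

Section Cvg.
Context {T : Type} (F : set_system T) {FF : Filter F}.
Variables (f : T -> 'M[R]_(1 + n)) (M : 'M[R]_(1 + n)).
Hypothesis cf : f @ F --> M.

Lemma cvg_ursubmx : (fun x => ursubmx (f x)) @ F --> ursubmx M.
Proof.
apply/cvg_mxP => k l; under eq_fun do rewrite !mxE; rewrite !mxE.
by move/cvg_mxP : cf; apply.
Qed.

Lemma cvg_pivot_col : (fun x => pivot_col (f x)) @ F --> pivot_col M.
Proof.
apply: cvgD; last apply: cvg_mulmx; first 1 [|exact: cvg_cst].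
- apply/cvg_mxP => k l; under eq_fun do rewrite !mxE; rewrite !mxE.
  by move/cvg_mxP : cf; apply.
- apply/cvg_mxP => k l; under eq_fun do rewrite !mxE; rewrite !mxE.
  by move/cvg_mxP : cf; apply.
Qed.

Lemma cvg_pivot_block : (fun x => pivot_block (f x)) @ F --> pivot_block M.
Proof.
apply: cvgD.
  apply/cvg_mxP => k l; under eq_fun do rewrite !mxE; rewrite !mxE.
  by move/cvg_mxP : cf; apply.
by apply: cvg_mulmx; [exact: cvg_cst|exact: cvg_ursubmx].
Qed.

Hypothesis Mi : pivot_col M i 0 != 0.

Lemma cvg_pivot_weight :
  (fun x => pivot_weight (f x)) @ F --> pivot_weight M.
Proof.
apply: cvgZ; last exact: cvg_cst.
apply: cvgM; first by apply: cvgB; [exact: cvg_cst|move/cvg_mxP : cf; apply].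
by apply: cvgV => //; move/cvg_mxP : cvg_pivot_col; apply.
Qed.

Lemma cvg_pivot_row : (fun x => pivot_row (f x)) @ F --> pivot_row M.
Proof.
apply: cvgD; first exact: cvg_ursubmx.
by apply: cvg_mulmx; [exact: cvg_pivot_weight|exact: cvg_pivot_block].
Qed.

Lemma cvg_schur : (fun x => schur (f x)) @ F --> schur M.
Proof.
apply: cvgB; first exact: cvg_pivot_block.
by apply: cvg_mulmx; [exact: cvg_pivot_col|exact: cvg_pivot_row].
Qed.

End Cvg.

Lemma det_schur M : pivot_col M i 0 != 0 -> \det (schur M) = \det M.
Proof.
move=> ci0; rewrite [in RHS](pivot_factor ci0) !det_mulmx !det_lblock.
by rewrite !det_ublock !det1 !mul1r mulr1.
Qed.

End Pivot.

(** If the column below the corner is nonzero, [v = 0] works. Otherwise the corner divides the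
    determinant, hence is nonzero, and the all-ones [v] copies it into every lower row. *)
Lemma pivot_exists n (M : 'M[R]_(1 + n.+1)) : \det M != 0 ->
  exists v i, pivot_col v M i 0 != 0.
Proof.
move=> dM; have [c0|/matrix0Pn[i [j cij]]] := eqVneq (dlsubmx M) 0; last first.
  by exists 0, i; rewrite /pivot_col mul0mx addr0 -(ord1 j).
exists (const_mx 1), 0; rewrite /pivot_col c0 add0r.
rewrite mxE big_ord1 mxE mul1r; apply: contraNneq dM => a0.
rewrite -(submxK M) c0 det_ublock det_mx11 a0 mul0r//.
Qed.

Context {X : topologicalType}.

(** Induction on the size through the Schur complement, which keeps the determinant. The choice of
    [v] and [i] made at [M0] is kept on the whole neighbourhood, so all factors depend continuously
    on the matrix. *)
Lemma flat_isotopic_near d (M0 : 'M[R]_d) : \det M0 = 1 ->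
  exists2 U, nbhs M0 U & forall A : X -> 'M[R]_d, continuous A ->
    (forall x, U (A x)) -> (forall x, \det (A x) = 1) -> flat_isotopic A.
Proof.
elim: d M0 => [|[|n] IH] M0 dM0.
- exists setT; first exact: filterT.
  move=> A _ _ _; suff -> : A = fun=> 1%:M by exact: flat_isotopic1.
  by apply/funext => x; rewrite flatmx0 [RHS]flatmx0.
(* Size 1 is treated apart because pivoting needs a row below the corner; determinant 1 leaves only
   the identity. *)
- exists setT; first exact: filterT.
  move=> A _ _ dA; suff -> : A = fun=> 1%:M by exact: flat_isotopic1.
  apply/funext => x; have := dA x; rewrite det_mx11 => A1.
  by rewrite [LHS]mx11_scalar A1.
have [|v [i vi]] := @pivot_exists n M0; first by rewrite dM0 oner_neq0.
have [U U0 hU] := IH (schur v i M0) (etrans (det_schur vi) dM0).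
exists [set M | pivot_col v M i 0 != 0 /\ U (schur v i M)].
  have cid : id @ nbhs M0 --> M0 by exact: cvg_id.
  apply: filterI; last exact: (cvg_schur cid vi U0).
  have ci := (cvg_mxP _ _).1 (cvg_pivot_col (v := v) cid) i 0.
  exact: cvgr_neq0 (ci _ _) vi.
move=> A cA UA dA.
have Ai x : pivot_col v (A x) i 0 != 0 by case: (UA x).
apply: (eq_flat_isotopic (fun x => pivot_factor (Ai x))).
apply: flat_isotopic_mul.
  by apply: flat_isotopic_unipotent_dl => x; exact: cvg_cst.
apply: flat_isotopic_mul.
  apply: flat_isotopic_unipotent_ur => x.
  by apply: cvgN; apply: cvg_pivot_weight => //; exact: cA.
apply: flat_isotopic_mul.
  by apply: flat_isotopic_unipotent_dl => x; apply: cvg_pivot_col; exact: cA.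
apply: flat_isotopic_mul.
  apply: flat_isotopic_diag; apply: hU.
  - by move=> x; apply: cvg_schur => //; exact: cA.
  - by move=> x; case: (UA x).
  - by move=> x; rewrite det_schur.
apply: flat_isotopic_unipotent_ur => x.
by apply: cvg_pivot_row => //; exact: cA.
Qed.

End LocalFactorization.

(** * Propagation of flat isotopy along a homotopy *)

Section Homotopy.
Context {R : realType} {X : topologicalType}.

Lemma flat_isotopic_homotopy d (H : X * R -> 'M[R]_d) (a b : R) :
  compact [set: X] -> continuous H -> (forall p, \det (H p) = 1) ->
  flat_isotopic (fun x => H (x, a)) -> flat_isotopic (fun x => H (x, b)).
Proof.
move=> cX cH dH.
pose K := [set t : R | flat_isotopic (fun x => H (x, t))].
have [U U1 hU] := @flat_isotopic_near R X d 1%:M (det1 _ _).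
have HV p : H p \in unitmx by rewrite unitmxE dH unitr1.
have det_div p q : \det (H p *m invmx (H q)) = 1.
  by rewrite det_mulmx det_inv !dH invr1 mulr1.
have cHs t : continuous (fun x => H (x, t)).
  move=> x; apply: (cvg_comp (fun y => (y, t)) H _ (cH (x, t))).
  by apply: (cvg_pair (F := nbhs x) (G := nbhs x) (H := nbhs t));
    [exact: cvg_id|exact: cvg_cst].
have cdiv s t : continuous (fun x => H (x, s) *m invmx (H (x, t))).
  move=> x; apply: cvg_mulmx; first exact: cHs.
  by apply: cvg_invmx => //; exact: cHs.
have trans s t : (forall x, U (H (x, t) *m invmx (H (x, s)))) -> K s -> K t.
  move=> Ut Ks; apply: (eq_flat_isotopic
    (A2 := fun x => (H (x, t) *m invmx (H (x, s))) *m H (x, s))).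
    by move=> x; rewrite mulmxKV.
  by apply: flat_isotopic_mul Ks; apply: hU.
(* Compactness of [X] makes the time neighbourhood uniform in [x]. One order of the quotient serves
   the openness of [K], the other that of its complement. *)
have near_div t0 : \forall t \near t0, [set: X] `<=`
    (fun x => U (H (x, t) *m invmx (H (x, t0))) /\
              U (H (x, t0) *m invmx (H (x, t)))).
  apply: ((compact_near_coveringP [set: X]).1 cX R (nbhs t0) (fun t x =>
    U (H (x, t) *m invmx (H (x, t0))) /\
    U (H (x, t0) *m invmx (H (x, t))))) => x _.
  have cf1 : (fun p => H (p.1, p.2)) @ (x, t0) --> H (x, t0).
    have -> : (fun p => H (p.1, p.2)) = H by apply/funext => -[].
    exact: cH.
  have cf2 : (fun p : X * R => H (p.1, t0)) @ (x, t0) --> H (x, t0).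
    by apply: (cvg_comp fst (fun y => H (y, t0)) (cvg_fst) (cHs t0 x)).
  have c1 := cvg_mulmx cf1 (cvg_invmx cf2 (fun p => dH _) (dH _)).
  have c2 := cvg_mulmx cf2 (cvg_invmx cf1 (fun p => dH _) (dH _)).
  rewrite mulmxV// in c1 c2.
  by apply: filterI; [exact: c1 U1|exact: c2 U1].
have Ko : open K.
  rewrite openE => t Kt; apply: filterS (near_div t) => s Us.
  by apply: trans Kt => x; case: (Us x).
have Kc : open (~` K).
  rewrite openE => t Kt; apply: filterS (near_div t) => s Us Ks.
  by apply: Kt; apply: trans Ks => x; case: (Us x).
have KT : K a -> K = setT.
  move=> Ka; have /connected_intervalP : is_interval [set: R] by [].
  apply; first by exists a.
  - by exists K => //; rewrite setTI.
  - by exists K; [rewrite -openC|rewrite setTI].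
by move=> /KT K_T; have : K b by rewrite K_T.
Qed.

End Homotopy.

(** * Recurrences for the discrete cocycle over all integers *)

Section DiscreteCocycleTheory.
Context {R : realType} {d : nat} {T : topologicalType}.
Variables (phi : homeo T) (A : T -> SL R d).
Implicit Types (n : int) (x : T).

Lemma det_SL (M : SL R d) : \det (set_val M) = 1.
Proof. exact: (set_valP M). Qed.

Lemma SL_unit (M : SL R d) : set_val M \in unitmx.
Proof. by rewrite unitmxE det_SL unitr1. Qed.

Lemma NegzSD1 m : Negz m.+1 + 1 = Negz m.
Proof. by rewrite !NegzE [X in - X]intS opprD addrAC addNr add0r. Qed.

Lemma PoszD1 m : Posz m + 1 = m.+1.
Proof. by rewrite intS addrC. Qed.

Lemma discrete_cocycleS n x : discrete_cocycle phi A (n + 1) x =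
  set_val (A (homeo_iter phi n x)) *m discrete_cocycle phi A n x.
Proof.
case: n => [m|[|m]]; first by rewrite PoszD1.
- by rewrite /= mulmxA mulmxV ?SL_unit// mul1mx.
- by rewrite NegzSD1 /= !mulmxA mulmxV ?SL_unit// mul1mx.
Qed.

Lemma discrete_cocycleSr n x : discrete_cocycle phi A (n + 1) x =
  discrete_cocycle phi A n (phi x) *m set_val (A x).
Proof.
pose Q m := discrete_cocycle phi A (m + 1) x =
  discrete_cocycle phi A m (phi x) *m set_val (A x).
(* Going from [m] to [m + 1] multiplies both sides on the left by the same invertible matrix; the
   equivalence lets the induction run in both directions. *)
have QS m : Q (m + 1) <-> Q m.
  rewrite /Q discrete_cocycleS [in RHS]discrete_cocycleS -mulmxA homeo_iterS.
  split=> [|->//].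
  exact: (can_inj (mulKmx (SL_unit (A (homeo_iter phi m (phi x)))))).
rewrite -/(Q n); elim: n => [|m Qm|m Qm].
- by rewrite /Q /= mulmx1 mul1mx.
- by rewrite -PoszD1; apply/QS.
- by apply/QS; rewrite -PoszD1 opprD subrK.
Qed.

Lemma det_discrete_cocycle n x : \det (discrete_cocycle phi A n x) = 1.
Proof.
case: n => m.
  by elim: m => [|m IH] /=; rewrite ?det1// det_mulmx det_SL IH mulr1.
rewrite /discrete_cocycle; elim: m.+1 => [|k IH] /=; rewrite ?det1//.
by rewrite det_mulmx det_inv det_SL invr1 mul1r IH.
Qed.

End DiscreteCocycleTheory.

(** * The canonical extension built from a flat path *)

Section Extension.
Context {R : realType} {d : nat} {T : topologicalType}.
Variables (phi : homeo T) (A : T -> SL R d).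
Variables (B G : T * R -> 'M[R]_d).
Hypothesis BG : flat_path (fun x => set_val (A x)) B G.
Local Notation cocycle := (discrete_cocycle phi A).

Lemma is_derive_shift_mx {m n : nat} (f : R -> 'M[R]_(m, n)) (t c : R) D :
  is_derive (t - c) 1 f D -> is_derive t 1 (fun s => f (s - c)) D.
Proof.
move=> /is_derive_mxP df; apply/is_derive_mxP => i j.
rewrite -[X in is_derive _ _ _ X]mulr1.
exact: (@is_derive1_comp R (fun s => f s i j) (fun s => s - c) t (D i j) 1
  (df i j) (@is_derive_shift R t 1 (- c))).
Qed.

(** The solution started at [(x, 0)]: the discrete cocycle up to the last integer time, then the
    flat path over the base point reached. *)
Definition ext_path (x : T) (s : R) : 'M[R]_d :=
  B (homeo_iter phi (Num.floor s) x, s - (Num.floor s)%:~R)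
  *m cocycle (Num.floor s) x.

Lemma det_ext_path x s : \det (ext_path x s) = 1.
Proof. by rewrite det_mulmx (flat_det BG) det_discrete_cocycle mulr1. Qed.

Lemma ext_path_int x (n : int) : ext_path x n%:~R = cocycle n x.
Proof. by rewrite /ext_path intrKfloor subrr (flat_le0 BG)// mul1mx. Qed.

(** This handles a torus point represented as [(x, 1)] instead of [(phi x, 0)]: its clock starts at
    1. *)
Lemma ext_path_intD1 x (n : int) :
  ext_path x (1 + n%:~R) = cocycle n (phi x) *m set_val (A x).
Proof.
by rewrite -[1]/(1%:~R) -intrD addrC ext_path_int discrete_cocycleSr.
Qed.

Lemma ext_path_zero01 x : ext_path x (set_val zero01) = 1%:M.
Proof. exact: (ext_path_int x 0). Qed.

Lemma ext_path_one01 x : ext_path x (set_val one01) = set_val (A x).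
Proof. by have := ext_path_intD1 x 0; rewrite addr0 mul1mx. Qed.

(** On (m, m + 2) one of the two [B] factors is always at rest, which makes the
    path visibly differentiable at the integer m + 1. *)
Lemma ext_pathE x (s : R) (m : int) : m%:~R < s < (m + 2)%:~R ->
  ext_path x s = B (homeo_iter phi (m + 1) x, s - (m + 1)%:~R) *m
    (B (homeo_iter phi m x, s - m%:~R) *m cocycle m x).
Proof.
rewrite (_ : m + 2 = m + 1 + 1) => [/andP[ms sm]|]; last by rewrite -addrA.
have [sm1|sm1] := ltP s (m + 1)%:~R.
  have fs : Num.floor s = m by apply: floor_def; rewrite (ltW ms).
  by rewrite /ext_path fs (flat_le0 BG _ (t := s - (m + 1)%:~R)) ?mul1mx//
    subr_le0 ltW.
have fs : Num.floor s = m + 1 by apply: floor_def; rewrite sm1.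
rewrite /ext_path fs [in RHS](flat_ge1 BG _ (t := s - m%:~R)).
  by rewrite -discrete_cocycleS.
by rewrite lerBrDr addrC; rewrite intrD in sm1.
Qed.

Lemma is_derive_ext_path x (t : R) :
  is_derive t 1 (ext_path x)
    (G (homeo_iter phi (Num.floor t) x, t - (Num.floor t)%:~R)
     *m ext_path x t).
Proof.
(* Starting one unit below the floor puts [t] strictly inside [(m, m + 2)], even when [t] is an
   integer. *)
pose m := Num.floor t - 1; have m1 : Num.floor t = m + 1 by rewrite subrK.
have /andP[mt tm] := floor_itv t.
have mt1 : m%:~R < t.
  by apply: lt_le_trans mt; rewrite ltr_int m1 ltrDl.
have tm2 : t < (m + 2)%:~R by move: tm; rewrite m1 -addrA.
pose F s := B (homeo_iter phi (m + 1) x, s - (m + 1)%:~R) *m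
    (B (homeo_iter phi m x, s - m%:~R) *m cocycle m x).
apply: (@near_eq_is_derive R R _ F).
  near=> s; rewrite /F -ext_pathE//; apply/andP; split; near: s.
    exact: lt_nbhsr.
  exact: lt_nbhsl.
have d1 := is_derive_shift_mx (flat_derive BG (homeo_iter phi (m + 1) x)
  (t - (m + 1)%:~R)).
have d2 := is_derive_shift_mx (flat_derive BG (homeo_iter phi m x)
  (t - m%:~R)).
have dF := is_derive_mulmx d1
  (is_derive_mulmx d2 (is_derive_cst (cocycle m x) t 1)).
apply: (is_derive_eq dF).
(* Since [m + 1 <= t], the earlier factor is at rest and its generator is zero, so only the later
   one contributes. *)
rewrite (@ext_pathE x t m) ?mt1// m1 (flat_gen_out BG _ (t := t - m%:~R)).
  by rewrite !mul0mx -!mulmxA mulmx0 addr0 mulmx0 addr0.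
by right; rewrite lerBrDr addrC; rewrite m1 intrD in mt.
Unshelve. all: by end_near. Qed.

Let tr_gen (p : T * I01 R) : G (p.1, set_val p.2) \in sl R d.
Proof. by rewrite inE; exact: (flat_tr BG). Qed.

Definition ext_gen0 (p : T * I01 R) : sl R d := SigSub (tr_gen p).

(** Distinct identified points have fibre coordinates 0 and 1, and [G] vanishes at both. *)
Lemma ext_gen0_glue (p q : T * I01 R) : torus_rel phi p q ->
  ext_gen0 p = ext_gen0 q.
Proof.
move=> /or3P[/eqP->//| |] /and3P[/eqP p1 /eqP q0 _]; apply: val_inj => /=;
  rewrite p1 q0 !(flat_gen_out BG)//; [left|right|right|left]; exact: lexx.
Qed.

Definition ext_gen (x : mapping_torus R phi) : sl R d :=
  ext_gen0 (repr (x : {eq_quot (torus_equiv R phi)}%qT)).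

Lemma torus_rel_repr (x : T) (r : I01 R) : torus_rel phi
  (repr (torus_pi phi x r : {eq_quot (torus_equiv R phi)}%qT)) (x, r).
Proof. by apply/eqmodP; rewrite reprK. Qed.

Lemma ext_genE (x : T) (r : I01 R) :
  ext_gen (torus_pi phi x r) = ext_gen0 (x, r).
Proof. by apply: ext_gen0_glue; exact: torus_rel_repr. Qed.

Lemma continuous_ext_gen : continuous ext_gen.
Proof.
apply: repr_comp_continuous => [|p q /eqP/eqmodP pq]; last first.
  by apply/eqP; exact: ext_gen0_glue.
apply: continuous_comp_initial.
suff : continuous (G \o fun p : T * I01 R => (p.1, set_val p.2)) by [].
move=> p; apply: continuous_comp; last exact: (flat_gen_cont BG).
apply: (cvg_pair (F := nbhs p) (G := nbhs p.1) (H := nbhs (set_val p.2))).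
  exact: cvg_fst.
by apply: (cvg_comp snd set_val cvg_snd); exact: initial_continuous.
Qed.

Let det_flow (x : T) (r t : R) :
  ext_path x (r + t) *m invmx (ext_path x r) \in SL R d.
Proof. by rewrite inE /SL/= det_mulmx det_inv !det_ext_path invr1 mulr1. Qed.

(** The transition matrix from time [r] to time [r + t] of the path over the chosen
    representative. *)
Definition ext_flow (x : mapping_torus R phi) (t : R) : SL R d :=
  let p := repr (x : {eq_quot (torus_equiv R phi)}%qT) in
  SigSub (det_flow p.1 (set_val p.2) t).

Lemma ext_flow_canonical : canonical_extension A ext_flow.
Proof.
split.
  exists ext_gen; first exact: continuous_ext_gen.
  move=> x; split.
    by rewrite set_valE /= addr0 mulmxV// unitmxE det_ext_path unitr1.
  move=> t; rewrite /ext_flow /susp_flow.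
  (* The suspension flow is computed on the same representative, so one case analysis serves both
     sides. *)
  case: (repr _) => y r; rewrite ext_genE set_valE /=.
  have -> : (fun s => ext_path y (set_val r + s) *m
      invmx (ext_path y (set_val r))) = (fun s =>
      ext_path y (s - - set_val r) *m invmx (ext_path y (set_val r))).
    by apply/funext => s; rewrite opprK addrC.
  have dC : is_derive (t - - set_val r) 1 (ext_path y) _ :=
    is_derive_ext_path y _.
  have := is_derive_mulmx (is_derive_shift_mx dC)
    (is_derive_cst (invmx (ext_path y (set_val r))) t 1).
  by rewrite mulmx0 addr0 opprK [t + _]addrC mulmxA.
move=> n x; rewrite /ext_flow set_valE /=.
have := torus_rel_repr x zero01.
(* The class of [(x, 0)] is represented by [(x, 0)] itself or by [(y, 1)] with [x = phi y]; the
   third case would force 0 = 1. *)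
case: (repr _) => y r /or3P[/eqP[-> ->]| |] /=.
- by rewrite ext_path_zero01 invmx1 mulmx1 add0r ext_path_int.
- move=> /and3P[/eqP/= -> _ /eqP/= ->].
  by rewrite ext_path_one01 ext_path_intD1 mulmxK// SL_unit.
- by move=> /and3P[/eqP/= E]; have := zero01_neq_one01 R; rewrite E eqxx.
Qed.

End Extension.

(** * Gronwall estimate and continuous dependence for linear equations *)

Section ContinuousDependence.
Context {R : realType}.

Lemma gronwall_affine (E E' : R -> R) (L c : R) : 0 <= L -> 0 <= c ->
  (forall t : R, is_derive t 1 E (E' t)) ->
  (forall t : R, 0 <= t <= 1 -> E' t <= L * E t + c) -> E 0 = 0 ->
  forall t : R, 0 <= t <= 1 -> E t <= c * expR L.
Proof.
move=> L0 c0 dE E'le E0.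
(* With the integrating factor, [g t = E t * expR (- L * t) - c * t] has derivative at most
   [c * (expR (- L * t) - 1) <= 0] on the unit interval. *)
pose g := E * (expR \o ( *%R (- L))) - c \*: (id : R -> R).
have dg (t : R) : is_derive t 1 g
    (E' t * expR (- L * t) + E t * (- L * expR (- L * t)) - c).
  have dL : is_derive t 1 ( *%R (- L)) (- L).
    have := is_deriveZ (- L) (is_derive_id t 1).
    by rewrite /GRing.scale/= mulr1.
  have dexp := is_derive1_comp (is_derive_expR (- L * t)) dL.
  have dgt := is_deriveB (is_deriveM (dE t) dexp)
    (is_deriveZ c (is_derive_id t 1)).
  by apply: (is_derive_eq dgt); rewrite /GRing.scale/=; ring.
have g_le (t : R) : 0 <= t <= 1 -> g t <= g 0.
  move=> /andP[t0 t1]; apply: (@ler0_derive1_le_cc R g 0 1) => //.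
  - move=> x; rewrite in_itv/= => /andP[x0 x1].
    rewrite derive1E; have [_ ->] := dg x.
    have ex : expR (- L * x) <= 1.
      by rewrite -expR0 ler_expR mulNr oppr_le0 mulr_ge0// ltW.
    have e0 := expR_ge0 (- L * x).
    have Ex : E' x <= L * E x + c by apply: E'le; rewrite !ltW.
    by have := ler_wpM2r e0 Ex; have := ler_wpM2l c0 ex; lra.
  - apply: continuous_subspaceT => x.
    apply/differentiable_continuous/derivable1_diffP.
    by have [] := dg x.
  - by rewrite in_itv/= t0 t1.
  - by rewrite in_itv/= lexx ler01.
move=> t t01; have := g_le t t01; case/andP: t01 => t0 t1.
have -> : g 0 = 0 by rewrite /g !fctE /= E0 mul0r scaler0 subrr.
have -> : g t = E t * expR (- L * t) - c * t by [].
rewrite subr_le0 mulNr expRN ler_pdivrMr ?expR_gt0// => /le_trans; apply.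
have eL : expR (L * t) <= expR L by rewrite ler_expR ler_piMr.
have := ler_wpM2l c0 (ler_pM t0 (expR_ge0 _) t1 eL).
by rewrite mul1r mulrA.
Qed.

(** The difference [D = F - H] satisfies [D' = a D + (a - b) H], a linear equation with a small
    source. Only [H] needs an a priori bound. *)
Lemma linear_ode_compare d (a b F H : R -> 'M[R]_d) (M K e : R) :
  (forall t : R, is_derive t 1 F (a t *m F t)) ->
  (forall t : R, is_derive t 1 H (b t *m H t)) ->
  F 0 = H 0 -> 0 <= M ->
  (forall t : R, 0 <= t <= 1 -> forall i j, `|a t i j| <= M) ->
  (forall t : R, 0 <= t <= 1 -> forall i j, `|H t i j| <= K) ->
  (forall t : R, 0 <= t <= 1 -> forall i j, `|a t i j - b t i j| <= e) ->
  forall t : R, 0 <= t <= 1 -> forall i j,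
    (F t i j - H t i j) ^+ 2 <=
    (d ^ 3)%:R * (e * K) ^+ 2 * expR ((d ^ 3)%:R * (2 * M + 1)).
Proof.
move=> dF dH FH0 M0 aM HK abe t t01 i j.
pose D s := F s - H s.
(* Gronwall is applied to the squared Frobenius norm of the difference. *)
pose E := \sum_i \sum_j (fun s => D s i j) ^+ 2.
pose E' s := \sum_i \sum_j \sum_k
  (2 * D s i j * (a s i k * D s k j + (a s i k - b s i k) * H s k j)).
have EE s : E s = \sum_i \sum_j D s i j ^+ 2.
  by rewrite /E fct_sumE; apply: eq_bigr => k _; rewrite fct_sumE.
have D_E s k l : D s k l ^+ 2 <= E s.
  rewrite EE (bigD1 k)//= (bigD1 l)//= -addrA lerDl addr_ge0//.
    by apply: sumr_ge0 => *; exact: sqr_ge0.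
  by apply: sumr_ge0 => *; apply: sumr_ge0 => *; exact: sqr_ge0.
have dE (s : R) : is_derive s 1 E (E' s).
  apply: is_derive_sum => k; apply: is_derive_sum => l.
  have dD : is_derive s 1 (fun r => D r k l) ((a s *m F s - b s *m H s) k l).
    by move: k l; apply/is_derive_mxP; exact: is_deriveB.
  apply: (is_derive_eq (is_deriveX 2 dD)).
  rewrite /GRing.scale/= expr1 -mulr_sumr; congr (_ * _).
  by rewrite !mxE -sumrB; apply: eq_bigr => m _; rewrite /D !mxE; ring.
have [e0|e0] := ltP e 0.
  have := abe t t01 i j; have := normr_ge0 (a t i j - b t i j).
  by move=> /le_trans h /h; rewrite leNgt e0.
have -> : F t i j - H t i j = D t i j by rewrite !mxE.
apply: le_trans (D_E t i j) _.
apply: (@gronwall_affine E E') => //.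
- by rewrite mulr_ge0// addr_ge0// mulr_ge0.
- by rewrite mulr_ge0// sqr_ge0.
- move=> s s01.
  (* The factor [d ^ 3] counts the triples of indices in [E']; each summand is bounded by the same
     quantity. *)
  have -> : (d ^ 3)%:R * (2 * M + 1) * E s + (d ^ 3)%:R * (e * K) ^+ 2 =
      \sum_(i < d) \sum_(j < d) \sum_(k < d) ((2 * M + 1) * E s + (e * K) ^+ 2).
    rewrite !sumr_const !card_ord -!mulrnA -[RHS]mulr_natl -mulrA -mulrDr.
    by rewrite !expnS expn0 muln1.
  apply: ler_sum => k _; apply: ler_sum => l _; apply: ler_sum => m _.
  have aM' := aM _ s01 k m; have HK' := HK _ s01 m l.
  have ab' := abe _ s01 k m; have D1 := D_E s k l; have D2 := D_E s m l.
  have p1 : 2 * D s k l * (a s k m * D s m l) <= 2 * M * E s.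
    have : D s k l * D s m l * a s k m <= `|D s k l * D s m l| * M.
      by apply: le_trans (ler_norm _) _; rewrite normrM; exact: ler_wpM2l.
    have : `|D s k l * D s m l| <= E s.
      by rewrite ler_norml; apply/andP; split; nra.
    by have := normr_ge0 (D s k l * D s m l); nra.
  (* Young's inequality [2 x z <= x ^ 2 + z ^ 2] separates the source term from [D]. *)
  have p2 : 2 * D s k l * ((a s k m - b s k m) * H s m l) <=
      E s + (e * K) ^+ 2.
    have : ((a s k m - b s k m) * H s m l) ^+ 2 <= (e * K) ^+ 2.
      rewrite -ler_sqrt ?sqr_ge0// !sqrtr_sqr normrM.
      by apply: le_trans (ler_norm _); apply: ler_pM.
    by set z := _ * H s m l => zK; have := sqr_ge0 (D s k l - z); nra.
  by nra.
- rewrite EE big1// => k _; rewrite big1// => l _.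
  by rewrite /D FH0 subrr mxE expr0n.
Qed.

Lemma compact_mx_bound {d : nat} (f : R -> 'M[R]_d) : continuous f ->
  exists2 K : R, 0 <= K &
    forall t : R, 0 <= t <= 1 -> forall i j, `|f t i j| <= K.
Proof.
move=> cf.
have : compact (f @` `[0, 1]).
  apply: continuous_compact; last exact: segment_compact.
  exact: continuous_subspaceT.
move=> /compact_bounded[N [_ /(_ (`|N| + 1))]].
rewrite (le_lt_trans (ler_norm _)) ?ltrDl// => /(_ isT) fN.
exists (`|N| + 1); first by rewrite addr_ge0.
move=> t t01 i j.
have : `|f t| <= `|N| + 1 by apply: fN; exists t => //=; rewrite in_itv.
apply: le_trans.
by rewrite [leRHS]/Num.Def.normr/= mx_normrE; exact: (le_bigmax _ _ (i, j)).
Qed.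

(** Two generators are carried: [b] drives the equation at all times, while the jointly continuous
    [a] agrees with it on the unit interval, where the estimates are made. *)
Lemma linear_ode_continuous_dependence {T : topologicalType} {d : nat}
    (a : T * R -> 'M[R]_d) (b F : T -> R -> 'M[R]_d) :
  continuous a ->
  (forall x (t : R), is_derive t 1 (F x) (b x t *m F x t)) ->
  (forall x (t : R), 0 <= t <= 1 -> b x t = a (x, t)) ->
  (forall x, F x 0 = 1%:M) ->
  forall x0 (e : R), 0 < e -> \forall x \near x0, forall t : R, 0 <= t <= 1 ->
    forall i j, `|F x t i j - F x0 t i j| <= e.
Proof.
move=> ca dF ba F0 x0 e e0.
have cax : continuous (fun t => a (x0, t)).
  move=> t; apply: (cvg_comp (fun s => (x0, s)) a _ (ca (x0, t))).
  by apply: (cvg_pair (F := nbhs t) (G := nbhs x0) (H := nbhs t));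
    [exact: cvg_cst|exact: cvg_id].
have [M M0 aM] := compact_mx_bound cax.
have cF : continuous (F x0).
  move=> t; apply/cvg_mxP => i j.
  have /is_derive_mxP/(_ i j)[/derivable1_diffP dFt _] := dF x0 t.
  exact: (differentiable_continuous dFt).
have [K K0 FK] := compact_mx_bound cF.
pose N : R := (d ^ 3)%:R.
(* [Q - 1] is the Gronwall constant when generators are bounded by [M + 1]. With [e' <= 1] that
   bound holds near [x0], and [e' * Q <= e] with [1 <= Q] gives [e' ^+ 2 * (Q - 1) <= e ^+ 2]. *)
pose Q := N * K ^+ 2 * expR (N * (2 * (M + 1) + 1)) + 1.
have Q1 : 1 <= Q by rewrite lerDr !mulr_ge0// ?sqr_ge0// expR_ge0.
pose e' := Num.min 1 (e / Q).
have Q0 : 0 < Q by exact: lt_le_trans Q1.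
have e'0 : 0 < e' by rewrite lt_min ltr01 divr_gt0.
(* Compactness of the unit interval makes the closeness of the generators uniform in time. *)
have near_a : \forall x \near x0, `[0, 1]%classic `<=`
    (fun t : R => forall i j, `|a (x, t) i j - a (x0, t) i j| <= e').
  have /compact_near_coveringP cov := @segment_compact R 0 1.
  apply: (cov T (nbhs x0) (fun x t =>
    forall i j, `|a (x, t) i j - a (x0, t) i j| <= e') (nbhs_filter x0)).
  move=> t _; suff : \forall p \near (t, x0), forall i j,
    `|a (p.2, p.1) i j - a (x0, p.1) i j| <= e' by [].
  apply: (filter_forall (nbhs_filter (t, x0))) => i.
  apply: (filter_forall (nbhs_filter (t, x0))) => j.
  have c1 : (fun p : R * T => a (p.2, p.1)) @ (t, x0) --> a (x0, t).
    apply: (cvg_comp (fun p : R * T => (p.2, p.1)) a _ (ca (x0, t))).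
    by apply: (cvg_pair (F := nbhs (t, x0)) (G := nbhs x0) (H := nbhs t));
      [exact: cvg_snd|exact: cvg_fst].
  have c2 : (fun p : R * T => a (x0, p.1)) @ (t, x0) --> a (x0, t).
    by apply: (cvg_comp fst (fun s => a (x0, s)) cvg_fst (cax t)).
  have cv : (fun p : R * T => a (p.2, p.1) i j - a (x0, p.1) i j)
      @ (t, x0) --> (0 : R).
    rewrite -(subrr (a (x0, t) i j)).
    exact: cvgB ((cvg_mxP _ _).1 c1 i j) ((cvg_mxP _ _).1 c2 i j).
  by have := (cvgr0_norm_le _ cv) e' e'0; apply.
apply: filterS near_a => x xa t t01 i j.
have xa' s : 0 <= s <= 1 -> forall i j, `|a (x, s) i j - a (x0, s) i j| <= e'.
  by move=> s01; apply: xa; rewrite /= in_itv.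
have eQ : e' * Q <= e by rewrite -ler_pdivlMr// ge_min lexx orbT.
have e'1 : e' <= 1 by rewrite ge_min lexx.
have cmp : (F x t i j - F x0 t i j) ^+ 2 <=
    N * (e' * K) ^+ 2 * expR (N * (2 * (M + 1) + 1)).
  apply: (linear_ode_compare (dF x) (dF x0)) => //.
  - by rewrite !F0.
  - by rewrite addr_ge0.
  - move=> s s01 k l; rewrite ba//.
    have := xa' s s01 k l; have := aM s s01 k l.
    have := ler_normD (a (x, s) k l - a (x0, s) k l) (a (x0, s) k l).
    by rewrite subrK; lra.
  - by move=> s s01 k l; rewrite !ba//; exact: xa'.
have e'e : e' <= e by apply: le_trans eQ; rewrite ler_peMr// ltW.
have cmp2 : (F x t i j - F x0 t i j) ^+ 2 <= e ^+ 2.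
  apply: (le_trans cmp).
  have -> : N * (e' * K) ^+ 2 * expR (N * (2 * (M + 1) + 1)) =
      e' ^+ 2 * (Q - 1).
    by rewrite /Q; ring.
  have := ler_pM (ltW e'0) (mulr_ge0 (ltW e'0) (ltW Q0)) e'e eQ.
  by have := sqr_ge0 e'; rewrite !expr2; nra.
by rewrite -(ger0_norm (ltW e0)) -ler_sqr ?nnegrE// !real_normK ?num_real.
Qed.

End ContinuousDependence.

(** A filter on the subtype is pushed to the ambient space, where compactness gives a cluster point
    in [K]; the initial topology pulls it back. *)
Lemma compact_set_type {X : topologicalType} (K : set X) :
  compact K -> compact [set: K].
Proof.
move=> cK F FF _.
have [|p [Kp clp]] := cK (set_val @ F) _.
  apply: (@filterS _ F _ setT); last exact: filterT.
  by move=> x _; exact: (set_valP x).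
exists (SigSub (mem_set Kp)); split=> // A B FA [_ [[U oU <-] Up UB]].
have GA : (set_val @ F) (set_val @` A).
  by apply: (@filterS _ F _ A _ _ FA) => x Ax; exists x.
have [_ [[x Ax <-] Ux]] := clp _ _ GA (open_nbhs_nbhs (conj oU Up)).
by exists x; split => //; exact: UB.
Qed.

(** * Retraction of the real line onto the unit interval *)

Section Clamp.
Context {R : realType}.

Fact clamp_subproof (t : R) : Num.max 0 (Num.min 1 t) \in I01 R.
Proof.
by rewrite inE /I01/= in_itv/= le_max lexx /= ge_max ler01 ge_min lexx.
Qed.

Definition clamp01 (t : R) : I01 R := SigSub (clamp_subproof t).

Lemma continuous_clamp01 : continuous clamp01.
Proof.
apply: continuous_comp_initial => t.
apply: (@continuous_max R R (cst 0) (Num.min 1)); first exact: cvg_cst.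
by apply: (@continuous_min R R (cst 1) id); [exact: cvg_cst|exact: cvg_id].
Qed.

Lemma continuous_pair_clamp01 {X : topologicalType} :
  continuous (fun p : X * R => (p.1, clamp01 p.2)).
Proof.
move=> p.
apply: (cvg_pair (F := nbhs p) (G := nbhs p.1) (H := nbhs (clamp01 p.2))).
  exact: cvg_fst.
by apply: (cvg_comp snd clamp01 cvg_snd); exact: continuous_clamp01.
Qed.

Lemma clamp01E (t : R) : 0 <= t <= 1 -> set_val (clamp01 t) = t.
Proof. by move=> /andP[t0 t1]; rewrite set_valE /= min_r// max_r. Qed.

End Clamp.

(** * The two implications *)

Section Equivalence.
Context {R : realType} {d : nat} {T : topologicalType}.
Variables (phi : homeo T) (A : T -> SL R d).

Lemma continuous_set_val {X : topologicalType} (K : set X) :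
  continuous (set_val : K -> X).
Proof. exact: initial_continuous. Qed.

(** The right-hand side is visibly continuous in [(x, t)]. At time 1 the floor jumps, but the two
    sides are then the glued points [(phi x, 0)] and [(x, 1)]. *)
Lemma susp_flow_clamp (x : T) (t : R) : 0 <= t <= 1 ->
  susp_flow t (torus_pi phi x zero01) = torus_pi phi x (clamp01 t).
Proof.
move=> t01; rewrite susp_flowE.
have -> : set_val zero01 + t = t by rewrite set_valE /= add0r.
case/andP: (t01) => t0; rewrite le_eqVlt => /predU1P[t1|t1].
  have -> : clamp01 t = one01.
    by apply: val_inj; rewrite -set_valE clamp01E// t1.
  rewrite t1 floor1 /=.
  have -> : frac01 (1 : R) = zero01.
    by apply: val_inj; rewrite /= floor1 subrr.
  apply/eqmodP; rewrite /= /torus_rel /torus_glue /=.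
  by rewrite !eqxx !orbT.
have f0 : Num.floor t = 0 by apply: floor_def; rewrite t0.
rewrite f0 /=; congr torus_pi; apply: val_inj.
by rewrite -!set_valE clamp01E// set_valE /= f0 subr0.
Qed.

Lemma canonical_extension_nullhomotopic
    (Phi : mapping_torus R phi -> R -> SL R d) :
  canonical_extension A Phi -> nullhomotopic R A.
Proof.
move=> [[G cG gen] can].
pose a (p : T * R) := set_val (G (torus_pi phi p.1 (clamp01 p.2))).
pose b x (t : R) := set_val (G (susp_flow t (torus_pi phi x zero01))).
pose F x (t : R) := set_val (Phi (torus_pi phi x zero01) t).
have ca : continuous a.
  suff : continuous ((set_val \o G) \o
      (\pi_({eq_quot (torus_equiv R phi)})%qT : _ -> mapping_torus R phi) \o
      fun p : T * R => (p.1, clamp01 p.2)) by [].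
  move=> p; apply: continuous_comp; first exact: continuous_pair_clamp01.
  apply: continuous_comp; first exact: pi_continuous.
  by apply: continuous_comp; [exact: cG|exact: continuous_set_val].
have dF x (t : R) : is_derive t 1 (F x) (b x t *m F x t).
  exact: (gen _).2.
have ba x (t : R) : 0 <= t <= 1 -> b x t = a (x, t).
  by move=> t01; rewrite /b susp_flow_clamp.
have F0 x : F x 0 = 1%:M by exact: (gen _).1.
have dep := linear_ode_continuous_dependence ca dF ba F0.
have one_SL : 1%:M \in SL R d by rewrite inE /SL/= det1.
exists (SigSub one_SL).
exists (fun p => Phi (torus_pi phi p.1 zero01) (1 - set_val p.2)); split.
- apply: continuous_comp_initial => -[x0 r0].
  suff : (fun p : T * I01 R => F p.1 (1 - set_val p.2)) @ (x0, r0) -->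
    F x0 (1 - set_val r0) by [].
  have rev01 (r : I01 R) : 0 <= 1 - set_val r <= 1.
    have : I01 R (set_val r) := set_valP r.
    by rewrite /I01/= in_itv/= => /andP[r0' r1]; apply/andP; split; lra.
  (* Joint continuity splits into continuity in time over the fixed point [x0] and closeness of
     [F x] to [F x0] uniformly in time, each taking half of [e]. *)
  have cF : (fun p : T * I01 R => F x0 (1 - set_val p.2)) @ (x0, r0) -->
      F x0 (1 - set_val r0).
    apply: (cvg_comp (fun p : T * I01 R => 1 - set_val p.2) (F x0)).
      apply: cvgB; first exact: cvg_cst.
      by apply: (cvg_comp snd set_val cvg_snd); exact: continuous_set_val.
    apply/cvg_mxP => i j.
    have [/derivable1_diffP dFt _] :=
      (is_derive_mxP _ _ _).1 (dF x0 (1 - set_val r0)) i j.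
    exact: (differentiable_continuous dFt).
  apply/cvg_mxP => i j; apply/cvgrPdist_le => e e0.
  have e2 : 0 < e / 2 by rewrite divr_gt0.
  have cFij := (cvgrPdist_le _ _).1 ((cvg_mxP _ _).1 cF i j) _ e2.
  near=> p.
  have h1 : `|F x0 (1 - set_val r0) i j - F x0 (1 - set_val p.2) i j| <= e / 2.
    by near: p; exact: cFij.
  have h2 :
      `|F p.1 (1 - set_val p.2) i j - F x0 (1 - set_val p.2) i j| <= e / 2.
    have : forall t : R, 0 <= t <= 1 -> forall i j,
        `|F p.1 t i j - F x0 t i j| <= e / 2.
      by near: p; exact: (cvg_fst (dep x0 _ e2)).
    by apply.
  rewrite (splitr e) -(subrKA (F x0 (1 - set_val p.2) i j)).
  apply: le_trans (ler_normD _ _) _; apply: lerD => //.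
  by rewrite distrC.
- move=> x; apply: val_inj; rewrite -!set_valE /=.
  have -> : 1 - set_val zero01 = 1 :> R by exact: subr0.
  by have := can 1 x; rewrite /= mulmx1.
- move=> x; apply: val_inj; rewrite -!set_valE /=.
  have -> : 1 - set_val one01 = 0 :> R by exact: subrr.
  exact: F0.
Unshelve. all: by end_near. Qed.

Lemma nullhomotopic_canonical_extension : compact [set: T] ->
  nullhomotopic R A ->
  exists Phi : mapping_torus R phi -> R -> SL R d, canonical_extension A Phi.
Proof.
move=> cT [y [H [cH H0 H1]]].
suff [B [G BG]] : flat_isotopic (R := R) (fun x => set_val (A x)).
  by exists (ext_flow BG); exact: ext_flow_canonical.
pose h (p : T * R) := set_val (H (p.1, clamp01 p.2)).
have h0 x : set_val (A x) = h (x, 0).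
  rewrite /h -H0; congr (set_val (H (x, _))).
  by apply: val_inj; rewrite -!set_valE clamp01E// lexx ler01.
(* The homotopy is followed backwards, from the constant map at time 1 to [A] at time 0. *)
apply: (eq_flat_isotopic h0); apply: (@flat_isotopic_homotopy R T d h 1) => //.
- suff : continuous ((set_val \o H) \o
      fun p : T * R => (p.1, clamp01 p.2)) by [].
  move=> p; apply: continuous_comp; first exact: continuous_pair_clamp01.
  by apply: continuous_comp; [exact: cH|exact: continuous_set_val].
- by move=> p; exact: det_SL.
have h1 x : h (x, 1) = set_val y.
  rewrite /h -(H1 x); congr (set_val (H (x, _))).
  by apply: val_inj; rewrite -!set_valE clamp01E// lexx ler01.
apply: (eq_flat_isotopic h1).
(* The constant map stays in the neighbourhood of its own value, so local factorization applies to
   it. *)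
have [U Uy hU] := @flat_isotopic_near R T d (set_val y) (det_SL y).
apply: hU => [x|x|x]; [exact: cvg_cst|exact: nbhs_singleton|exact: det_SL].
Qed.

End Equivalence.

Theorem theorem3p3 (R : realType) (n d : nat) (Theta : set 'rV[R]_n)
    (phi : homeo Theta) (A : Theta -> SL R d) :
  smooth_manifold Theta -> compact Theta -> continuous A ->
  (exists Phi : mapping_torus R phi -> R -> SL R d,
     canonical_extension A Phi) <-> nullhomotopic R A.
Proof.
move=> _ cTheta _; split=> [[Phi]|].
  exact: canonical_extension_nullhomotopic.
by apply: nullhomotopic_canonical_extension; exact: compact_set_type.
Qed.
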